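(* Let $G$ be a finite group. Then $G$ is nilpotent if and only if $\varphi(S)\neq 0$ for every section $S$ of $G$.
   Context: For a finite group $S$, $o(a)$ denotes the order of an element $a\in S$, $\exp(S)$ denotes the exponent of $S$ (the least common multiple of the orders of its elements), and $\varphi(S)=|\{a\in S \mid o(a)=\exp(S)\}|$. A section of $G$ is a quotient group $H/K$, where $H$ is a subgroup of $G$ and $K$ is a normal subgroup of $H$. *)

(* Defs.v *)
From mathcomp Require Import all_boot all_fingroup all_solvable.

Set Implicit Arguments.
Unset Strict Implicit.
Unset Printing Implicit Defensive.

Definition phi (gT : finGroupType) (S : {set gT}) : nat :=
  #|[set a in S | #[a]%g == exponent S]|.

(* Main.v *)
Require Import Defs.
From mathcomp Require Import all_boot all_fingroup all_solvable.

(** In a nilpotent group the elements of maximal prime-power order in the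
    various Sylow subgroups commute, so their product has order the exponent;
    and nilpotency passes to sections.

    Conversely, among the sections of [G] that are not nilpotent take one,
    [S], of least order.  Its proper subgroups are nilpotent, and its center is
    trivial, since otherwise [S / 'Z(S)] and hence [S] would be nilpotent.
    Let [a] in [S] have order [exponent S]; every prime divisor of [#|S|] then
    divides [#[a]].

    - [a] lies in a maximal subgroup [M], which is nilpotent.  If no Sylow
      subgroup of [M] were normal in [S], each would have normaliser [M], hence
      be a Sylow subgroup of [S]; as every prime divisor of [#|S|] divides
      [#|M|], this would force [M = S].  So ['O_p(S)] is nontrivial for some
      [p] ([exponent_elt_pcore_neq1]), and [N = 'Z('O_p(S))] is a nontrivial
      abelian normal p-subgroup.
    - [S = N Q] for every Sylow q-subgroup [Q], for some [q] distinct from [p]: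
      if not, Sylow subgroups for all primes other than [p] centralise [N], and
      the central elements of a Sylow p-subgroup lying in [N] are central in
      [S] ([exists_Sylow_supplement]).
    - The centraliser of the p-part of [a] is proper, hence nilpotent, and
      contains [N] and the q-part of [a].  So that q-part is a nontrivial element
      of a Sylow subgroup [Q] centralising [N], and then ['C_Q(N)] meets
      ['Z(Q)] in nontrivial central elements of [S = N Q]: a contradiction
      ([min_nonnil_exponent_elt_center]). *)

Set Implicit Arguments.
Unset Strict Implicit.
Unset Printing Implicit Defensive.

Import GroupScope.

Lemma phi_neq0P (gT : finGroupType) (S : {set gT}) :
  reflect (exists2 a, a \in S & #[a] = exponent S) (phi S != 0).
Proof.
rewrite /phi cards_eq0; apply: (iffP (set0Pn _)) => [[a]|[a Sa oa]].
  by rewrite inE => /andP[Sa /eqP oa]; exists a.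
by exists a; rewrite inE Sa oa eqxx.
Qed.

Section MinimalNonNilpotent.

Variables (gT : finGroupType) (G : {group gT}).
Implicit Types (H M N P Q : {group gT}) (p q : nat) (a : gT).

Lemma pi_exponent_elt a p :
  #[a] = exponent G -> p \in \pi(G) -> p \in \pi(#[a]).
Proof. by rewrite -pi_of_exponent => ->. Qed.

Lemma constt_neq1 a p : p \in \pi(#[a]) -> a.`_p != 1.
Proof. by move=> pa; rewrite -order_gt1 order_constt p_part_gt1. Qed.

(** Normalisers grow in p-groups: a Sylow p-subgroup of [G] properly containing
    [P] would normalise a larger p-subgroup than [P]. *)
Lemma Sylow_of_norm p P :
  P \subset G -> p.-Sylow('N_G(P)) P -> p.-Sylow(G) P.
Proof.
move=> sPG sylP; have pP := pHall_pgroup sylP.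
have [S sylS sPS] := Sylow_superset sPG pP.
have pS := pHall_pgroup sylS.
suff -> : P = S by [].
apply/val_inj/eqP; rewrite /= eqEproper sPS; apply/negP => ltPS.
have := nilpotent_proper_norm (pgroup_nil pS) ltPS.
have sN : 'N_S(P) \subset 'N_G(P) by rewrite setSI ?(pHall_sub sylS).
have sPN : P \subset 'N_S(P) by rewrite subsetI sPS normG.
have pN : p.-group 'N_S(P) by apply: pgroupS pS; apply: subsetIl.
by rewrite (sub_pHall sylP pN sPN sN) properxx.
Qed.

Lemma sub_Sylows_eq H :
    H \subset G ->
    (forall p, p \in \pi(G) -> exists2 P : {group gT}, p.-Sylow(G) P & P \subset H) ->
  H = G.
Proof.
move=> sHG sylH; apply/val_inj/eqP; rewrite /= eqEcard sHG /=.
apply/dvdn_leq => //; apply/dvdn_partP => // p /sylH[P sylP sPH].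
by rewrite -(card_Hall sylP) cardSg.
Qed.

Hypothesis properG_nil : forall H, H \proper G -> nilpotent H.

(** A maximal subgroup containing [a] has order divisible by every prime divisor
    of [#|G|], and a Sylow subgroup of it whose normaliser is not [G] is a
    Sylow subgroup of [G]: this cannot happen for all primes. *)
Lemma exponent_elt_pcore_neq1 a :
    ~~ nilpotent G -> a \in G -> #[a] = exponent G ->
  exists2 p, prime p & 'O_p(G) :!=: 1.
Proof.
move=> nnilG Ga oa.
have sAG : <[a]> \subset G by rewrite cycle_subG.
have [eqAG | [M maxM sAM]] := maximal_exists sAG.
  by rewrite -eqAG abelian_nil ?cycle_abelian in nnilG.
have ltMG := maxgroupp maxM; have sMG := proper_sub ltMG.
have nilM := properG_nil ltMG.
case: (boolP (has (fun p => 'O_p(G) :!=: 1) (primes #|G|))) => [/hasP[p]|/hasPn O1].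
  by rewrite mem_primes => /and3P[p_pr _ _]; exists p.
suff eqMG : M = G by rewrite -eqMG nilM in nnilG.
apply: sub_Sylows_eq => // p piGp.
exists 'O_p(M)%G; last exact: pcore_sub.
have sylMP : p.-Sylow(M) 'O_p(M) := nilpotent_pcore_Hall p nilM.
have sPG : 'O_p(M) \subset G := subset_trans (pcore_sub _ _) sMG.
have neqP1 : 'O_p(M) :!=: 1.
  have piMp : p \in \pi(M).
    apply: (pi_of_dvd _ _ (pi_exponent_elt oa piGp)).
      by rewrite order_dvdG // -cycle_subG.
    exact: cardG_gt0.
  by rewrite -cardG_gt1 (card_Hall sylMP) p_part_gt1.
apply: Sylow_of_norm => //=.
have sMN : M \subset 'N_G('O_p(M)) by rewrite subsetI sMG gFnorm.
suff -> : 'N_G('O_p(M)) = M by [].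
case/maxgroupP: maxM => _ maxM; apply: maxM => //=.
rewrite properE subsetIl; apply/negP => sGN.
have nPG : 'O_p(M) <| G.
  by rewrite /normal sPG; apply: subset_trans sGN (subsetIr _ _).
have := pcore_max (pcore_pgroup p M) nPG.
by move: (O1 p piGp); rewrite negbK => /eqP->; rewrite subG1 (negPf neqP1).
Qed.

Hypothesis Z1 : 'Z(G) = 1.

(** If [N Q] is proper it is nilpotent, so [Q] centralises [N].  Were there such
    a [Q] for every [q] distinct from [p], the centraliser of the nontrivial
    group [N :&: 'Z(S)], [S] a Sylow p-subgroup, would contain a Sylow subgroup
    for every prime. *)
Lemma exists_Sylow_supplement p N :
    N <| G -> p.-group N -> N :!=: 1 ->
  exists2 q, q \in \pi(G) & q != p /\
    forall Q, q.-Sylow(G) Q -> N * Q = G.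
Proof.
move=> nsNG pN neqN1; have [sNG nNG] := andP nsNG.
have nNQ Q q : q.-Sylow(G) Q -> Q \subset 'N(N).
  by move=> sylQ; apply: subset_trans nNG; apply: pHall_sub sylQ.
pose good q := (q != p) &&
  [forall Q : {group gT}, q.-Sylow(G) Q ==> (N * Q == G)].
case: (boolP (has good (primes #|G|))) => [/hasP[q piq]|/hasPn bad].
  case/andP=> neqp /forallP/= gq; exists q => //; split=> // Q sylQ.
  by have /implyP/(_ sylQ)/eqP := gq Q.
have [S sylS] := Sylow_exists p G; have pS := pHall_pgroup sylS.
have sNS : N \subset S by rewrite (normal_sub_max_pgroup (Hall_max sylS)).
have nsNS : N <| S := normalS sNS (pHall_sub sylS) nsNG.
have /negP[] := meet_center_nil (pgroup_nil pS) nsNS neqN1.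
suff eqCG : 'C_G(N :&: 'Z(S))%G = G.
  rewrite -subG1 -Z1 subsetI subIset ?sNG //= centsC.
  by rewrite -{1}eqCG subsetIr.
apply: sub_Sylows_eq => [|q piq]; first exact: subsetIl.
have [->|neqqp] := eqVneq q p.
  exists S => //; rewrite subsetI (pHall_sub sylS) centsC.
  by apply: subset_trans (subsetIr _ _) _; apply: subsetIr.
have := bad q piq; rewrite /good neqqp /= => /forallPn[Q].
rewrite negb_imply => /andP[sylQ neqNQ]; exists Q => //.
have sQG := pHall_sub sylQ.
rewrite subsetI sQG; apply: subset_trans (centS (subsetIl _ _)).
have ltNQ : N <*> Q \proper G.
  by rewrite properEneq join_subG sNG sQG norm_joinEr ?(nNQ _ q) // neqNQ.
apply: (sub_nilpotent_cent2 (properG_nil ltNQ)).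
- exact: joing_subl.
- exact: joing_subr.
- apply: (@pnat_coprime p) => //; rewrite /pnat.
  by apply: pi_pnat (pHall_pgroup sylQ) _; rewrite !inE.
Qed.

(** [G = N Q] makes [N] the Sylow p-subgroup of [G], so the p-part of [a] lies
    in [N] and, [N] being abelian, is centralised by it; the q-part of [a]
    commutes with the p-part as both are powers of [a].  As the center is
    trivial, the centraliser of the p-part is proper. *)
Lemma min_nonnil_exponent_elt_center a :
  a \in G -> #[a] = exponent G -> nilpotent G.
Proof.
move=> Ga oa; apply: contraT => nnilG.
have [p p_pr neqO1] := exponent_elt_pcore_neq1 nnilG Ga oa.
pose N := 'Z('O_p(G))%G.
have pO : p.-group 'O_p(G) := pcore_pgroup p G.
have pN : p.-group N := pgroupS (center_sub _) pO.
have nsNG : N <| G := gFnormal_trans _ (pcore_normal p G).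
have neqN1 : N :!=: 1.
  by apply: contraNneq neqO1 => N1; rewrite -(trivg_center_pgroup pO).
have abN : abelian N := center_abelian _.
clearbody N; have [q piq [neqqp NQ_G]] := exists_Sylow_supplement nsNG pN neqN1.
have Gconstt r : a.`_r \in G by rewrite groupX.
have sYG : <[a.`_q]> \subset G by rewrite cycle_subG.
have [Q sylQ sYQ] := Sylow_superset sYG (p_elt_constt q a).
have [sQG qQ] := (pHall_sub sylQ, pHall_pgroup sylQ).
have p'Q : p^'.-group Q by apply: pi_pnat qQ _; rewrite !inE.
have sylN : p.-Sylow(G) N.
  rewrite pHallE (normal_sub nsNG) -{1}(NQ_G Q sylQ) /=.
  rewrite (TI_cardMg (coprime_TIg (pnat_coprime pN p'Q))).
  by rewrite partnM // (part_pnat_id pN) (part_p'nat p'Q) muln1.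
have piGp : p \in \pi(G).
  have [_ pG _] := pgroup_pdiv pN neqN1.
  by rewrite mem_primes p_pr cardG_gt0 (dvdn_trans pG) ?cardSg ?normal_sub.
have Nx : a.`_p \in N.
  by rewrite (mem_normal_Hall sylN nsNG) ?p_elt_constt.
have ltCG : 'C_G[a.`_p] \proper G.
  rewrite properE subsetIl; apply/negP => sGC.
  have /negP[] := constt_neq1 (pi_exponent_elt oa piGp).
  rewrite -cycle_eq1 -subG1 -Z1 subsetI !cycle_subG Gconstt.
  by rewrite -sub_cent1 (subset_trans sGC) ?subsetIr.
have cNY : <[a.`_q]> \subset 'C(N).
  apply: (sub_nilpotent_cent2 (properG_nil ltCG)).
  - rewrite subsetI (normal_sub nsNG) sub_cent1.
    exact: subsetP abN _ Nx.
  - rewrite cycle_subG inE Gconstt; apply/cent1P.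
    by apply: commuteX2.
  - exact: pnat_coprime pN (pgroupS sYQ p'Q).
have nNQ : Q \subset 'N(N) := subset_trans sQG (normal_norm nsNG).
have nsCQ : 'C_Q(N) <| Q.
  by rewrite /normal subsetIl normsI ?normG ?norms_cent.
have neqC1 : 'C_Q(N) :!=: 1.
  have : <[a.`_q]> :!=: 1.
    by rewrite cycle_eq1 (constt_neq1 (pi_exponent_elt oa piq)).
  by apply: contraNneq => C1; rewrite -subG1 -C1 subsetI sYQ.
have /negP[] := meet_center_nil (pgroup_nil qQ) nsCQ neqC1.
rewrite -subG1 -Z1 subsetI; apply/andP; split.
  by rewrite !subIset // sQG.
rewrite -[X in 'C(X)](NQ_G Q sylQ) centM.
by apply: setISS; apply: subsetIr.
Qed.

End MinimalNonNilpotent.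

(** Induction on the order of the section [H / K]: its subgroups are sections
    [L / K] with [L] in [H], and its central quotient is isomorphic to [H / K']
    with [K'] the preimage of the center. *)
Lemma section_exponent_elt_nilpotent (gT : finGroupType) (G : {group gT}) :
    (forall H K : {group gT}, H \subset G -> K <| H ->
      exists2 a, a \in H / K & #[a] = exponent (H / K)) ->
  forall H K : {group gT}, H \subset G -> K <| H -> nilpotent (H / K).
Proof.
move=> phiG H K; have [n] := ubnP #|H / K|.
elim: n H K => // n IHn H K /ltnSE-leHKn sHG nsKH.
have [Z1 | neqZ1] := eqVneq 'Z(H / K) 1.
  have [a HKa oa] := phiG H K sHG nsKH.
  apply: min_nonnil_exponent_elt_center Z1 a HKa oa => L ltLH.
  have [L' defL sKL' sL'H] := inv_quotientS nsKH (proper_sub ltLH).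
  have := proper_card ltLH; rewrite defL => ltLHcard.
  apply: IHn; first exact: leq_trans leHKn.
    exact: subset_trans sHG.
  exact: normalS sKL' sL'H nsKH.
have [K' defZ sKK' nsK'H] := inv_quotientN nsKH (center_normal (H / K)).
rewrite -quotient_center_nil /= defZ.
rewrite (isog_nil (third_isog sKK' nsKH nsK'H)).
apply: IHn => //; apply: leq_trans leHKn.
rewrite -(card_isog (third_isog sKK' nsKH nsK'H)) -defZ.
by apply: ltn_quotient neqZ1 _; apply: center_sub.
Qed.

Theorem theorem1 (gT : finGroupType) (G : {group gT}) :
  nilpotent G <->
  (forall H K : {group gT}, H \subset G -> (K <| H)%g -> phi (H / K)%g <> 0).
Proof.
split=> [nilG H K sHG _ | phiG].
  have nilHK : nilpotent (H / K) := quotient_nil K (nilpotentS sHG nilG).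
  have [a HKa oa] := exponent_witness nilHK.
  by apply/eqP/phi_neq0P; exists a.
rewrite (isog_nil (quotient1_isog G)).
apply: (section_exponent_elt_nilpotent (G := G)) => //; last exact: normal1.
by move=> H K sHG nsKH; apply/phi_neq0P/eqP/phiG.
Qed.
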